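(* Let $\mathcal{T}=(t_n)_{n=0}^\infty$ be the Thue-Morse sequence over $\mathbb{F}_2$. For every $N=1,2,\ldots$, the $N$th expansion complexity $E(\mathcal{T},N)$ of $\mathcal{T}$ is at most $5$.
   Context: The Thue-Morse sequence $\mathcal{T}=(t_n)_{n=0}^\infty$ over $\mathbb{F}_2=\{0,1\}$ is defined by $t_0=0$ and, for $n\ge 1$, $t_n=t_{n/2}$ if $n$ is even and $t_n=t_{(n-1)/2}+1$ (addition in $\mathbb{F}_2$) if $n$ is odd. For a binary sequence $\mathcal{S}=(s_n)_{n=0}^\infty$ with $s_n\in\mathbb{F}_2$, let $G(x)=\sum_{n=0}^\infty s_nx^n\in\mathbb{F}_2[[x]]$ be its generating function. For $N\ge 1$, if $(s_0,\ldots,s_{N-1})\neq(0,\ldots,0)$, the $N$th expansion complexity $E(\mathcal{S},N)$ is the smallest (total) degree of a nonzero polynomial $h(x,y)\in\mathbb{F}_2[x,y]$ with $h(x,G(x))\equiv 0 \bmod x^N$. If $(s_0,\ldots,s_{N-1})=(0,\ldots,0)$, one sets $E(\mathcal{S},N)=0$. *)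

(* Defs.v *)
From HB Require Import structures.
From mathcomp Require Import all_boot all_order all_algebra.
From mathcomp Require Import boolp.
From mathcomp Require Export mpoly.

Set Implicit Arguments.
Unset Strict Implicit.
Unset Printing Implicit Defensive.

Import GRing.Theory.
Local Open Scope ring_scope.

(* The ring R[[x]]: the coercion sends a series to its coefficient sequence,  *)
(* so f i is the coefficient of x^i in f, and Fps s is the generating         *)
(* function of the sequence s.                                                *)
Record fps (R : Type) := Fps { fps_coef :> nat -> R }.

HB.instance Definition _ (R : Type) := gen_eqMixin (fps R).
HB.instance Definition _ (R : Type) := gen_choiceMixin (fps R).

Lemma fpsP (R : Type) (f g : fps R) : (forall i, f i = g i) <-> f = g.
Proof.
split=> [|-> //]; case: f g => [f] [g] /= fg.
by congr Fps; apply/funext.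
Qed.

Definition fps_add (R : comNzRingType) (f g : fps R) := Fps (fun i => f i + g i).
Definition fps_opp (R : comNzRingType) (f : fps R) := Fps (fun i => - f i).
Definition fps_const (R : comNzRingType) (c : R) :=
  Fps (fun i => if i == 0%N then c else 0).
Definition fps_mul (R : comNzRingType) (f g : fps R) :=
  Fps (fun i => \sum_(j < i.+1) f j * g (i - j)%N).
Definition fpsX (R : comNzRingType) : fps R := Fps (fun i => (i == 1%N)%:R).

Lemma fps_addA (R : comNzRingType) : associative (@fps_add R).
Proof. by move=> f g h; apply/fpsP => i /=; rewrite addrA. Qed.
Lemma fps_addC (R : comNzRingType) : commutative (@fps_add R).
Proof. by move=> f g; apply/fpsP => i /=; rewrite addrC. Qed.
Lemma fps_add0 (R : comNzRingType) : left_id (fps_const 0) (@fps_add R).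
Proof. by move=> f; apply/fpsP => i /=; rewrite if_same add0r. Qed.
Lemma fps_addN (R : comNzRingType) :
  left_inverse (fps_const 0) (@fps_opp R) (@fps_add R).
Proof. by move=> f; apply/fpsP => i /=; rewrite if_same addNr. Qed.

HB.instance Definition _ (R : comNzRingType) := GRing.isZmodule.Build (fps R)
  (@fps_addA R) (@fps_addC R) (@fps_add0 R) (@fps_addN R).

Definition fps_trunc (R : comNzRingType) (n : nat) (f : fps R) : {poly R} :=
  \poly_(i < n) f i.

Lemma fps_mul_trunc (R : comNzRingType) (n i : nat) (f g : fps R) : (i < n)%N ->
  fps_mul f g i = (fps_trunc n f * fps_trunc n g)`_i.
Proof.
move=> lt_in; rewrite coefM; apply: eq_bigr => j _; rewrite !coef_poly.
rewrite (leq_trans (ltn_ord j) lt_in).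
by rewrite (leq_ltn_trans (leq_subr j i) lt_in).
Qed.

Lemma fps_mulC (R : comNzRingType) : commutative (@fps_mul R).
Proof.
move=> f g; apply/fpsP => i.
by rewrite !(fps_mul_trunc _ _ (ltnSn i)) mulrC.
Qed.

Lemma coefM_low (R : comNzRingType) (p q r : {poly R}) (i : nat) :
  (forall j, (j <= i)%N -> p`_j = q`_j) -> (p * r)`_i = (q * r)`_i.
Proof.
by move=> pq; rewrite !coefM; apply: eq_bigr => j _; rewrite pq // -ltnS.
Qed.

Lemma fps_trunc_mul (R : comNzRingType) (n j : nat) (f g : fps R) : (j < n)%N ->
  (fps_trunc n (fps_mul f g))`_j = (fps_trunc n f * fps_trunc n g)`_j.
Proof. by move=> lt_jn; rewrite coef_poly lt_jn (fps_mul_trunc _ _ lt_jn). Qed.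

Lemma fps_mulA (R : comNzRingType) : associative (@fps_mul R).
Proof.
move=> f g h; apply/fpsP => i; rewrite !(fps_mul_trunc _ _ (ltnSn i)).
have low (a b : fps R) j : (j <= i)%N -> (fps_trunc i.+1 (fps_mul a b))`_j =
    (fps_trunc i.+1 a * fps_trunc i.+1 b)`_j by move=> ?; apply: fps_trunc_mul.
by rewrite mulrC (coefM_low _ (low g h)) mulrC mulrA (coefM_low _ (low f g)).
Qed.

Lemma fps_mul1 (R : comNzRingType) : left_id (fps_const 1) (@fps_mul R).
Proof.
move=> f; apply/fpsP => i /=; rewrite big_ord_recl /= mul1r subn0.
by rewrite big1 ?addr0 // => j _; rewrite mul0r.
Qed.

Lemma fps_mulD (R : comNzRingType) :
  left_distributive (@fps_mul R) (@fps_add R).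
Proof.
move=> f g h; apply/fpsP => i /=.
by rewrite -big_split; apply: eq_bigr => j _; rewrite mulrDl.
Qed.

Lemma fps_1neq0 (R : comNzRingType) : fps_const (1 : R) != fps_const 0.
Proof. by apply/eqP => /fpsP/(_ 0%N)/= /eqP; rewrite oner_eq0. Qed.

HB.instance Definition _ (R : comNzRingType) :=
  GRing.Zmodule_isComNzRing.Build (fps R)
    (@fps_mulA R) (@fps_mulC R) (@fps_mul1 R) (@fps_mulD R) (@fps_1neq0 R).

Lemma fps_const_is_additive (R : comNzRingType) : additive (@fps_const R).
Proof. by move=> a b; apply/fpsP => -[|i] //=; rewrite subr0. Qed.
HB.instance Definition _ (R : comNzRingType) :=
  GRing.isAdditive.Build R (fps R) (@fps_const R) (@fps_const_is_additive R).

Lemma fps_const_is_multiplicative (R : comNzRingType) :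
  multiplicative (@fps_const R).
Proof.
split=> // a b; apply/fpsP => -[|i] /=; first by rewrite big_ord1.
by rewrite big_ord_recl big1 /= ?mulr0 ?addr0 // => j _; rewrite mul0r.
Qed.
HB.instance Definition _ (R : comNzRingType) :=
  GRing.isMultiplicative.Build R (fps R) (@fps_const R)
    (@fps_const_is_multiplicative R).

(* h(x, G(x)) in R[[x]], the variables of h being x = 'X_0 and y = 'X_1.      *)
Definition eval_xy (R : comNzRingType) (h : {mpoly R[2]}) (G : fps R) : fps R :=
  mmap (@fps_const R) (fun i : 'I_2 => if i == ord0 then fpsX R else G) h.

Definition fps_zero_mod (R : comNzRingType) (N : nat) (f : fps R) : Prop :=
  exists q : fps R, f = fpsX R ^+ N * q.

(* msize is one more than the total degree of a nonzero polynomial.           *)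
Definition annihilator_degree (F : fieldType) (s : nat -> F) (N d : nat) : Prop :=
  exists h : {mpoly F[2]},
    [/\ h != 0, (msize h).-1 = d & fps_zero_mod N (eval_xy h (Fps s))].

Lemma annihilator_degree_ex (F : fieldType) (s : nat -> F) (N : nat) :
  exists d, `[< annihilator_degree s N d >].
Proof.
exists (msize ('X_(ord0 : 'I_2) ^+ N : {mpoly F[2]})).-1; apply/asboolP.
exists ('X_ord0 ^+ N); split=> //.
  by rewrite mpolyXn -msize_poly_eq0 msizeX.
by exists 1; rewrite mulr1 /eval_xy rmorphXn /= mmapX mmap1U.
Qed.

Definition expansion_complexity (F : fieldType) (s : nat -> F) (N : nat) : nat :=
  if [forall i : 'I_N, s i == 0] then 0%N
  else ex_minn (annihilator_degree_ex s N).

(* fuel bounds the number of halvings; n + 1 steps suffice to reach t_0.      *)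
Fixpoint thue_morse_rec (fuel n : nat) : 'F_2 :=
  if fuel is fuel'.+1 then
    if n == 0%N then 0
    else if odd n then thue_morse_rec fuel' n.-1./2 + 1
    else thue_morse_rec fuel' n./2
  else 0.

Definition thue_morse (n : nat) : 'F_2 := thue_morse_rec n.+1 n.

Lemma half_uphalf_leq (n : nat) : (n./2 <= n)%N && (uphalf n <= n)%N.
Proof.
by rewrite leq_half_double leq_uphalf_double -addnn leq_addr leqW ?leq_addr.
Qed.

Lemma thue_morse_fuel (m n : nat) : (n < m)%N -> thue_morse_rec m n = thue_morse n.
Proof.
suff gen a b p : (p < a)%N -> (p < b)%N ->
  thue_morse_rec a p = thue_morse_rec b p by move=> lt_nm; apply: gen.
elim: a b p => // a IH [//|b] [//|p] /= pa pb.
have /andP[hp hu] := half_uphalf_leq p.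
have IHp q : (q <= p)%N -> thue_morse_rec a q = thue_morse_rec b q.
  by move=> le_qp; apply: IH; apply: leq_ltn_trans le_qp _.
by rewrite !IHp.
Qed.

Lemma thue_morse0 : thue_morse 0 = 0.
Proof. by []. Qed.

Lemma thue_morseE (n : nat) : (0 < n)%N ->
  thue_morse n = if odd n then thue_morse n.-1./2 + 1 else thue_morse n./2.
Proof.
case: n => // n _; have /andP[hp hu] := half_uphalf_leq n.
by rewrite -(thue_morse_fuel (m := n.+1) (n := n.+1.-1./2)) //
  -(thue_morse_fuel (m := n.+1) (n := n.+1./2)).
Qed.

(* Main.v *)
(* In characteristic 2 the squared series G^2 is G(x^2), so the Thue-Morse    *)
(* recursion reads G = (1 + x) G^2 + x / (1 + x)^2. Clearing the denominator, *)
(* (1 + x)^3 y^2 + (1 + x)^2 y + x, of total degree 5, vanishes at y = G      *)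
(* exactly, hence modulo every power of x.                                    *)
Require Import Defs.
From mathcomp Require Import all_boot all_order all_algebra.
From mathcomp Require Import boolp ring.

Set Implicit Arguments.
Unset Strict Implicit.
Unset Printing Implicit Defensive.

Import GRing.Theory.
Local Open Scope ring_scope.

(** One nonzero polynomial of degree at most 5 that kills [G] exactly bounds the complexity for
    every [N] at once, by minimality. Squaring over F_2 only spreads out coefficients, so
    [thue_morse_gf_rec] encodes the recursion as a quadratic equation; its right side is x / (1 +
    x)^2, which makes it polynomial in [thue_morse_gf_algebraic]. *)

Lemma coef_fps_sqr_pchar2 (R : comNzRingType) (f : fps R) (i : nat) :
  2 \in [pchar R] -> (f ^+ 2) i = if odd i then 0 else f i./2 ^+ 2.
Proof.
move=> ch2; have ch2p : 2 \in [pchar {poly R}] by rewrite pchar_poly.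
rewrite expr2 [LHS](fps_mul_trunc _ _ (ltnSn i)) -expr2.
(* On the truncation, squaring is the additive Frobenius map, so it acts term by term. *)
rewrite -(pFrobenius_autE ch2p) /fps_trunc poly_def raddf_sum coef_sum /=.
have lt : (i./2 < i.+1)%N by rewrite ltnS; have /andP[] := half_uphalf_leq i.
have sqrE (j : nat) :
    (pFrobenius_aut ch2p (f j *: 'X^j))`_i = f j ^+ 2 * (i == j.*2)%:R.
  by rewrite pFrobenius_autE exprZn -exprM coefZ coefXn muln2.
rewrite (bigD1 (Ordinal lt)) //= sqrE big1 ?addr0 => [|j].
  have -> : (i == i./2.*2) = ~~ odd i.
    by rewrite -{1}[i]odd_double_half -{2}[_.*2]add0n eqn_add2r; case: odd.
  by case: odd; rewrite /= ?mulr1 ?mulr0.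
rewrite -val_eqE /= sqrE; case: (i =P _) => [i2j /eqP[]|_ _].
  by rewrite [in RHS]i2j doubleK.
by rewrite mulr0.
Qed.

Lemma coef_fpsXM (R : comNzRingType) (f : fps R) (i : nat) :
  (fpsX R * f) i = if i is k.+1 then f k else 0.
Proof.
rewrite [LHS]/=; case: i => [|i]; first by rewrite big_ord1 mul0r.
rewrite 2!big_ord_recl /= mul0r add0r mul1r subSS subn0 big1 ?addr0 // => j _.
by rewrite mul0r.
Qed.

Lemma sqr_F2 (a : 'F_2) : a ^+ 2 = a.
Proof. by case: a => [[|[|]]] // ?; apply/val_inj. Qed.

Lemma addrr_F2 (a : 'F_2) : a + a = 0.
Proof. by case: a => [[|[|]]] // ?; apply/val_inj. Qed.

(* Coefficientwise this is t_(2k) = t_k and t_(2k+1) = t_k + 1. *)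
Lemma thue_morse_gf_rec (G := Fps thue_morse) (X := fpsX 'F_2) :
  G + (1 + X) * G ^+ 2 = Fps (fun i => (odd i)%:R).
Proof.
apply/fpsP => i; rewrite mulrDl mul1r.
rewrite [LHS](_ : _ = G i + ((G ^+ 2) i + (X * G ^+ 2) i)) //.
have ch2 : 2 \in [pchar 'F_2] by exact: pchar_Fp.
rewrite coef_fpsXM; case: i => [|i].
  by rewrite coef_fps_sqr_pchar2 /= ?sqr_F2 ?addr0 ?thue_morse0.
(* At a positive index exactly one of [G ^+ 2] and [X * G ^+ 2] contributes, according to parity. *)
rewrite !coef_fps_sqr_pchar2 //= !sqr_F2 thue_morseE //=.
by case: odd; rewrite /= ?addr0 ?add0r ?addrr_F2 // addrAC addrr_F2 add0r.
Qed.

Lemma fps_addrr_F2 (f : fps 'F_2) : f + f = 0.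
Proof. by apply/fpsP => i; rewrite [LHS]addrr_F2 /= if_same. Qed.

Lemma thue_morse_gf_algebraic (G := Fps thue_morse) (X := fpsX 'F_2) :
  (1 + X) ^+ 3 * G ^+ 2 + (1 + X) ^+ 2 * G + X = 0.
Proof.
have oddE : (1 + X) ^+ 2 * Fps (fun i => (odd i)%:R) = X.
  (* Here (1 + X)^2 = 1 + X^2, and the parity series cancels against its shift by two except at
     index 1. *)
  rewrite sqrrD expr1n mul1r mulr2n fps_addrr_F2 addr0 mulrDl mul1r expr2 -mulrA.
  apply/fpsP => i; rewrite [LHS](_ : _ = (odd i)%:R +
    (X * (X * Fps (fun i => (odd i)%:R))) i) // coef_fpsXM.
  case: i => [|[|i]]; rewrite ?coef_fpsXM /= ?addr0 //.
  by rewrite negbK addrr_F2.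
transitivity ((1 + X) ^+ 2 * (G + (1 + X) * G ^+ 2) + X); first by ring.
by rewrite thue_morse_gf_rec oddE fps_addrr_F2.
Qed.

Definition thue_morse_annihilator : {mpoly 'F_2[2]} :=
  (1 + 'X_ord0) ^+ 3 * 'X_ord_max ^+ 2 + (1 + 'X_ord0) ^+ 2 * 'X_ord_max
  + 'X_ord0.

Lemma thue_morse_annihilator_neq0 : thue_morse_annihilator != 0.
Proof.
(* At x = y = 1 the factors 1 + x vanish, leaving the value 1. *)
apply/eqP => /(congr1 (meval (fun=> 1))); rewrite /thue_morse_annihilator.
rewrite !(rmorphD, rmorphM, rmorphXn, rmorph1, rmorph0) /= !mevalXU.
by move/eqP.
Qed.

Lemma leq_msizeM (n : nat) (R : idomainType) (p q : {mpoly R[n]}) (a b : nat) :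
  (msize p <= a.+1)%N -> (msize q <= b.+1)%N -> (msize (p * q) <= (a + b).+1)%N.
Proof.
have [->|p0] := eqVneq p 0; first by rewrite mul0r msize0.
have [->|q0] := eqVneq q 0; first by rewrite mulr0 msize0.
by move=> pa qb; rewrite msizeM // -subn1 leq_subLR add1n -addnS -addSn leq_add.
Qed.

Lemma leq_msizeXn (n : nat) (R : idomainType) (p : {mpoly R[n]}) (a k : nat) :
  (msize p <= a.+1)%N -> (msize (p ^+ k) <= (a * k).+1)%N.
Proof.
move=> pa; elim: k => [|k IHk]; first by rewrite expr0 msize1.
by rewrite exprS mulnS leq_msizeM.
Qed.

Lemma leq_msizeD (n : nat) (R : nzRingType) (p q : {mpoly R[n]}) (a : nat) :
  (msize p <= a)%N -> (msize q <= a)%N -> (msize (p + q) <= a)%N.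
Proof. by move=> pa qa; rewrite (leq_trans (msizeD_le _ _)) // geq_max pa. Qed.

Lemma msize_thue_morse_annihilator : (msize thue_morse_annihilator <= 6)%N.
Proof.
have sX (i : 'I_2) : (msize ('X_i : {mpoly 'F_2[2]}) <= 2)%N.
  by rewrite msizeX mdeg1.
have s1X : (msize (1 + 'X_ord0 : {mpoly 'F_2[2]}) <= 2)%N.
  by rewrite leq_msizeD ?msize1.
(* The three summands have degrees at most 3 + 2, 2 + 1 and 1. *)
rewrite !leq_msizeD //; last exact: leq_trans (sX _) _.
  exact: leq_msizeM (leq_msizeXn 3 s1X) (leq_msizeXn 2 (sX _)).
exact: leq_trans (leq_msizeM (leq_msizeXn 2 s1X) (sX _)) _.
Qed.

Lemma eval_xy_thue_morse_annihilator :
  eval_xy thue_morse_annihilator (Fps thue_morse) = 0.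
Proof.
rewrite /eval_xy /thue_morse_annihilator.
rewrite !(rmorphD, rmorphM, rmorphXn, rmorph1) /= !mmapX !mmap1U /=.
exact: thue_morse_gf_algebraic.
Qed.

Theorem corollary3 (N : nat) (hN : (1 <= N)%N) :
  (expansion_complexity thue_morse N <= 5)%N.
Proof.
rewrite /expansion_complexity; case: ifP => // _.
case: ex_minnP => d _ /(_ (msize thue_morse_annihilator).-1) le_d.
apply: (@leq_trans (msize thue_morse_annihilator).-1); last first.
  by rewrite -subn1 leq_subLR msize_thue_morse_annihilator.
apply: le_d; apply/asboolP; exists thue_morse_annihilator; split=> //.
  exact: thue_morse_annihilator_neq0.
(* The vanishing is exact, so the cofactor of x^N is 0. *)
by exists 0; rewrite mulr0 eval_xy_thue_morse_annihilator.
Qed.
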